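(* Let $A,F,L_n,L_s,L_p,\varepsilon_n,\varepsilon_s,\varepsilon_p,D_{en},D_{es},D_{ep},c_e^0>0$ and $0\le t^+<1$ be real constants. For $I\in\mathbb R$ let $\widehat c_{en,c}(I)$ and $\widehat c_{ep,c}(I)$ be the lithium-ion concentrations at the anode collector and at the cathode collector, as defined in the context. Then $\widehat c_{en,c}$ and $\widehat c_{ep,c}$ are affine functions of $I$, and, setting $$I_e^-=\frac{c_e^0}{c_e^0-\widehat c_{en,c}(1)},\qquad I_e^+=\frac{c_e^0}{c_e^0-\widehat c_{ep,c}(1)},$$ these quantities are well defined, $I_e^-<0<I_e^+$, $\widehat c_{en,c}(I_e^-)=0$, $\widehat c_{ep,c}(I_e^+)=0$, and the two concentrations $\widehat c_{en,c}(I)$ and $\widehat c_{ep,c}(I)$ are both non-negative if and only if $I\in[I_e^-,I_e^+]$.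
   Context: The subscripts $n$, $s$, $p$ refer to the negative electrode, separator and positive electrode; $L_k$ are lengths, $\varepsilon_k$ porosities, $D_{ek}$ ion diffusion coefficients ($k\in\{n,s,p\}$), $A$ the cross-section area, $F$ Faraday's constant, $t^+$ the transfer number, $c_e^0$ the initial ion concentration, and $I$ the current intensity. Put $M^0=(\varepsilon_nL_n+\varepsilon_sL_s+\varepsilon_pL_p)\,c_e^0$. For each $I\in\mathbb R$, the average concentrations $(\widehat c_{en}(I),\widehat c_{es}(I),\widehat c_{ep}(I))$ are the solution of the linear system $$\widehat c_{en}(I)=\widehat c_{es}(I)+\frac{1-t^+}{AF}\left(\frac{L_n}{3D_{en}}+\frac{L_s}{2D_{es}}\right)I,$$ $$\widehat c_{ep}(I)=\widehat c_{es}(I)-\frac{1-t^+}{AF}\left(\frac{L_p}{3D_{ep}}+\frac{L_s}{2D_{es}}\right)I,$$ $$\varepsilon_nL_n\widehat c_{en}(I)+\varepsilon_sL_s\widehat c_{es}(I)+\varepsilon_pL_p\widehat c_{ep}(I)=M^0.$$ The concentrations at the collectors are $$\widehat c_{en,c}(I)=\widehat c_{en}(I)+\frac{1-t^+}{AF}\frac{L_n}{6D_{en}}I,\qquad \widehat c_{ep,c}(I)=\widehat c_{ep}(I)-\frac{1-t^+}{AF}\frac{L_p}{6D_{ep}}I.$$ *)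

(* Defs.v *)
From Stdlib Require Export Reals.
Open Scope R_scope.

(* Subscripts: n = negative electrode (anode side), s = separator,
   p = positive electrode (cathode side).  The sign conditions on the
   parameters are hypotheses of the theorem, not part of the record. *)
Record cell := Cell {
  area : R;                        (* cross-section area A *)
  faraday : R;                     (* Faraday's constant F *)
  L_n : R; L_s : R; L_p : R;       (* lengths *)
  eps_n : R; eps_s : R; eps_p : R; (* porosities *)
  D_en : R; D_es : R; D_ep : R;    (* ion diffusion coefficients *)
  c_e0 : R;                        (* initial ion concentration *)
  t_plus : R                       (* transfer number *)
}.

Definition M0 (b : cell) : R :=
  (eps_n b * L_n b + eps_s b * L_s b + eps_p b * L_p b) * c_e0 b.

Record averages := Averages { c_en : R; c_es : R; c_ep : R }.

Definition solves_average_system (b : cell) (I : R) (c : averages) : Prop :=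
  c_en c = c_es c + (1 - t_plus b) / (area b * faraday b)
                    * (L_n b / (3 * D_en b) + L_s b / (2 * D_es b)) * I
  /\ c_ep c = c_es c - (1 - t_plus b) / (area b * faraday b)
                    * (L_p b / (3 * D_ep b) + L_s b / (2 * D_es b)) * I
  /\ eps_n b * L_n b * c_en c + eps_s b * L_s b * c_es c
     + eps_p b * L_p b * c_ep c = M0 b.

(* Collector concentrations, given the averages [c] at every current. *)
Definition c_en_c (b : cell) (c : R -> averages) (I : R) : R :=
  c_en (c I)
  + (1 - t_plus b) / (area b * faraday b) * (L_n b / (6 * D_en b)) * I.

Definition c_ep_c (b : cell) (c : R -> averages) (I : R) : R :=
  c_ep (c I)
  - (1 - t_plus b) / (area b * faraday b) * (L_p b / (6 * D_ep b)) * I.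

Definition affine (f : R -> R) : Prop :=
  exists a b : R, forall x : R, f x = a * x + b.

(* [Rdiv] is total: a zero denominator gives an unspecified value, so the
   theorem asserts separately that both denominators are nonzero. *)
Definition I_e_minus (b : cell) (c : R -> averages) : R :=
  c_e0 b / (c_e0 b - c_en_c b c 1).

Definition I_e_plus (b : cell) (c : R -> averages) : R :=
  c_e0 b / (c_e0 b - c_ep_c b c 1).

(* Main.v *)
Require Import Defs.
From Stdlib Require Import Reals Lra.
Open Scope R_scope.

(** Eliminating the averages from the linear system gives
    [c_en_c I = c_e0 + s_n * I] and [c_ep_c I = c_e0 - s_p * I] with
    [s_n, s_p > 0].  An affine function [f] with [f 0 = c0] and nonzero slope
    vanishes exactly at [c0 / (c0 - f 1)], so the sign of each concentration is
    that of the distance to its root, taken with the sign of the slope. *)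

(** Substituting the first two equations into the third leaves [(wn + ws + wp) * z = (wn + ws + wp)
    * c0 + wp * q - wn * p], which determines [z] and then [x] and [y]. Being an equivalence, it
    yields both existence and uniqueness of the averages. *)
Lemma average_system_solution (wn ws wp c0 p q x z y : R) :
  wn + ws + wp <> 0 ->
  (x = z + p /\ y = z - q /\ wn * x + ws * z + wp * y = (wn + ws + wp) * c0)
  <->
  (x = c0 + ((ws + wp) * p + wp * q) / (wn + ws + wp) /\
   z = c0 + (wp * q - wn * p) / (wn + ws + wp) /\
   y = c0 - (wn * p + (wn + ws) * q) / (wn + ws + wp)).
Proof.
intros hw; split.
- intros [-> [-> h]].
  assert (hz : z = c0 + (wp * q - wn * p) / (wn + ws + wp)).
  { apply (Rmult_eq_reg_l (wn + ws + wp)); [|exact hw].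
    replace ((wn + ws + wp) * (c0 + (wp * q - wn * p) / (wn + ws + wp)))
      with ((wn + ws + wp) * c0 + wp * q - wn * p) by (field; exact hw).
    lra. }
  rewrite hz; repeat split; field; exact hw.
- intros [-> [-> ->]]; repeat split; field; exact hw.
Qed.

(** Here [c0 - f 1 = - s], so the quotient [c0 / (c0 - f 1)] is [- c0 / s], the root of [f]. *)
Lemma affine_root (f : R -> R) (c0 s : R) :
  (forall x, f x = c0 + s * x) -> s <> 0 ->
  c0 - f 1 <> 0 /\ (forall x, f x = s * (x - c0 / (c0 - f 1))).
Proof.
intros hf hs; rewrite (hf 1).
assert (h : c0 - (c0 + s * 1) <> 0) by lra.
split; [exact h|]; intros x; rewrite hf.
field; lra.
Qed.

Lemma scaled_diff_ge0 (s x r : R) : 0 < s -> 0 <= s * (x - r) <-> r <= x.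
Proof.
intros hs; split; intros h.
- assert (0 <= x - r) by (apply (Rmult_le_reg_l s); lra); lra.
- apply Rmult_le_pos; lra.
Qed.

Lemma scaled_diff_gt0 (s x r : R) : 0 < s -> 0 < s * (x - r) -> r < x.
Proof.
intros hs h.
assert (0 < x - r) by (apply (Rmult_lt_reg_l s); lra); lra.
Qed.

Theorem mainTheorem1 (b : cell)
  (hA : 0 < area b) (hF : 0 < faraday b)
  (hLn : 0 < L_n b) (hLs : 0 < L_s b) (hLp : 0 < L_p b)
  (hen : 0 < eps_n b) (hes : 0 < eps_s b) (hep : 0 < eps_p b)
  (hDn : 0 < D_en b) (hDs : 0 < D_es b) (hDp : 0 < D_ep b)
  (hc : 0 < c_e0 b) (ht : 0 <= t_plus b < 1) :
  (forall I : R, exists! c : averages, solves_average_system b I c) /\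
  (forall c : R -> averages,
    (forall I : R, solves_average_system b I (c I)) ->
    affine (c_en_c b c) /\ affine (c_ep_c b c) /\
    c_e0 b - c_en_c b c 1 <> 0 /\ c_e0 b - c_ep_c b c 1 <> 0 /\
    I_e_minus b c < 0 < I_e_plus b c /\
    c_en_c b c (I_e_minus b c) = 0 /\ c_ep_c b c (I_e_plus b c) = 0 /\
    (forall I : R,
      (0 <= c_en_c b c I /\ 0 <= c_ep_c b c I) <->
      I_e_minus b c <= I <= I_e_plus b c)).
Proof.
set (wn := eps_n b * L_n b); set (ws := eps_s b * L_s b).
set (wp := eps_p b * L_p b); set (W := wn + ws + wp).
set (k := (1 - t_plus b) / (area b * faraday b)).
set (an := k * (L_n b / (3 * D_en b) + L_s b / (2 * D_es b))).
set (ap := k * (L_p b / (3 * D_ep b) + L_s b / (2 * D_es b))).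
assert (hwn : 0 < wn) by (apply Rmult_lt_0_compat; assumption).
assert (hws : 0 < ws) by (apply Rmult_lt_0_compat; assumption).
assert (hwp : 0 < wp) by (apply Rmult_lt_0_compat; assumption).
assert (hW : 0 < W) by (unfold W; lra).
assert (hk : 0 < k).
{ apply Rdiv_lt_0_compat; [lra | apply Rmult_lt_0_compat; assumption]. }
assert (hr : forall m L D, 0 < m -> 0 < L -> 0 < D -> 0 < L / (m * D)).
{ intros m L D hm hL hD; apply Rdiv_lt_0_compat; [exact hL|].
  apply Rmult_lt_0_compat; assumption. }
assert (han : 0 < an).
{ apply Rmult_lt_0_compat; [exact hk|].
  apply Rplus_lt_0_compat; apply hr; lra. }
assert (hap : 0 < ap).
{ apply Rmult_lt_0_compat; [exact hk|].
  apply Rplus_lt_0_compat; apply hr; lra. }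
assert (hsol : forall I x, solves_average_system b I x <->
  c_en x = c_e0 b + ((ws + wp) * (an * I) + wp * (ap * I)) / W /\
  c_es x = c_e0 b + (wp * (ap * I) - wn * (an * I)) / W /\
  c_ep x = c_e0 b - (wn * (an * I) + (wn + ws) * (ap * I)) / W).
(* The system has the shape of the lemma with [p := an * I] and [q := ap * I]; [M0 b] unfolds to
   [W * c_e0 b]. *)
{ intros I x; apply average_system_solution; fold W; lra. }
split.
{ intros I.
  exists (Averages (c_e0 b + ((ws + wp) * (an * I) + wp * (ap * I)) / W)
                   (c_e0 b + (wp * (ap * I) - wn * (an * I)) / W)
                   (c_e0 b - (wn * (an * I) + (wn + ws) * (ap * I)) / W)).
  split.
  - apply hsol; repeat split.
  - intros [x z y] hx; apply hsol in hx; simpl in hx.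
    destruct hx as [-> [-> ->]]; reflexivity. }
intros c hcs.
(* In each slope, the first term is the coefficient of [I] in the closed form of the average, up to
   sign for [sp]; the second is the collector correction. *)
set (sn := ((ws + wp) * an + wp * ap) / W + k * (L_n b / (6 * D_en b))).
set (sp := (wn * an + (wn + ws) * ap) / W + k * (L_p b / (6 * D_ep b))).
assert (hmul : forall x y u v, 0 < x -> 0 < y -> 0 < u -> 0 < v ->
  0 < (x * y + u * v) / W).
{ intros x y u v hx hy hu hv; apply Rdiv_lt_0_compat; [|exact hW].
  apply Rplus_lt_0_compat; apply Rmult_lt_0_compat; assumption. }
assert (hsn : 0 < sn).
{ apply Rplus_lt_0_compat; [apply hmul; lra|].
  apply Rmult_lt_0_compat; [exact hk | apply hr; lra]. }
assert (hsp : 0 < sp).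
{ apply Rplus_lt_0_compat; [apply hmul; lra|].
  apply Rmult_lt_0_compat; [exact hk | apply hr; lra]. }
assert (hfn : forall I, c_en_c b c I = c_e0 b + sn * I).
{ intros I; destruct (proj1 (hsol I (c I)) (hcs I)) as [h _].
  unfold c_en_c, sn; rewrite h; fold k; field; repeat split; lra. }
assert (hfp : forall I, c_ep_c b c I = c_e0 b + - sp * I).
{ intros I; destruct (proj1 (hsol I (c I)) (hcs I)) as [_ [_ h]].
  unfold c_ep_c, sp; rewrite h; fold k; field; repeat split; lra. }
destruct (affine_root _ _ _ hfn) as [hn0 hn]; [lra|].
destruct (affine_root _ _ _ hfp) as [hp0 hp]; [lra|].
fold (I_e_minus b c) in hn; fold (I_e_plus b c) in hp.
(* The cathode slope is [- sp]; moving the sign into the difference leaves the positive factor [sp],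
   as the sign lemmas require. *)
assert (hp' : forall I, c_ep_c b c I = sp * (I_e_plus b c - I)).
{ intros I; rewrite hp; ring. }
repeat match goal with |- _ /\ _ => split end.
- exists sn, (c_e0 b); intros I; rewrite hfn; ring.
- exists (- sp), (c_e0 b); intros I; rewrite hfp; ring.
- exact hn0.
- exact hp0.
(* The sign of each root follows from the value at zero current, which is [c_e0 b > 0]. *)
- apply (scaled_diff_gt0 sn); [exact hsn|].
  rewrite <- hn, hfn; lra.
- apply (scaled_diff_gt0 sp); [exact hsp|].
  rewrite <- hp', hfp; lra.
- rewrite hn; ring.
- rewrite hp; ring.
- intros I; rewrite hn, hp'.
  now rewrite (scaled_diff_ge0 sn), (scaled_diff_ge0 sp).
Qed.
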